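(* Let $G$ be a finite group and $L_C(G)=\{H\in L(G): H \text{ is cyclic}\}$. If $S=(G\times G)\sqcup L_C(G)$, then \[ {\Pr}_{\mathrm{cyc}}(G)=\frac{\sum_{H\in L_C(G)}\deg_{\mathcal{B}(G)[S]}(H)}{|G|^2}=\frac{|e(\mathcal{B}(G)[S])|}{|G|^2}. \]
   Context: For a group $G$, let $L(G)$ be the set of all subgroups of $G$. The graph $\mathcal{B}(G)$ is the simple undirected bipartite graph with vertex set the disjoint union $V(\mathcal{B}(G)) = (G\times G) \sqcup L(G)$, in which $(a,b)\in G\times G$ and $H \in L(G)$ are adjacent if and only if $H = \langle a,b\rangle$, and there are no other edges. For $S\subseteq V(\mathcal{B}(G))$, $\mathcal{B}(G)[S]$ is the subgraph of $\mathcal{B}(G)$ induced by $S$; $e(\Gamma)$ is the edge set of a graph $\Gamma$ and $\deg_\Gamma$ the degree in $\Gamma$. ${\Pr}_{\mathrm{cyc}}(G)=\dfrac{|\{(a,b)\in G\times G: \langle a,b\rangle \text{ is cyclic}\}|}{|G|^2}$ is the cyclicity degree of $G$. *)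

(* Defs.v *)
From mathcomp Require Import all_boot all_order all_algebra all_fingroup all_solvable.
Set Implicit Arguments.
Unset Strict Implicit.
Unset Printing Implicit Defensive.
Import GRing.Theory.

(* The vertex set is a subset of an ambient finite type, so that an induced
   subgraph has vertices of the same type as the original graph. *)
Record sgraph (T : finType) := SGraph {
  vertices : {set T};
  adj : rel T;
  adj_sym : symmetric adj;
  adj_irr : irreflexive adj;
  adj_vertex : forall x y, adj x y -> x \in vertices }.

Definition edges (T : finType) (Gamma : sgraph T) : {set {set T}} :=
  [set [set p.1; p.2] | p : T * T & adj Gamma p.1 p.2].

Definition deg (T : finType) (Gamma : sgraph T) (x : T) : nat :=
  #|[set y | adj Gamma x y]|.

Section Induced.
Variables (T : finType) (Gamma : sgraph T) (S : {set T}).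

Definition induced_adj : rel T :=
  fun x y => [&& x \in S, y \in S & adj Gamma x y].

Lemma induced_sym : symmetric induced_adj.
Proof. by move=> x y; rewrite /induced_adj adj_sym andbCA. Qed.

Lemma induced_irr : irreflexive induced_adj.
Proof. by move=> x; rewrite /induced_adj adj_irr !andbF. Qed.

Lemma induced_vertex x y : induced_adj x y -> x \in vertices Gamma :&: S.
Proof. by case/and3P=> xS _ /adj_vertex xV; rewrite inE xV. Qed.

Definition induced : sgraph T := SGraph induced_sym induced_irr induced_vertex.

End Induced.

Definition disjoint_union (T1 T2 : finType) (A : {set T1}) (B : {set T2}) :
    {set T1 + T2} :=
  [set inl x | x in A] :|: [set inr y | y in B].

Section GeneratingGraph.
Local Open Scope group_scope.
Variables (gT : finGroupType) (G : {group gT}).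

Definition bvertex : finType := ((gT * gT) + {group gT})%type.

Definition B_vertices : {set bvertex} :=
  disjoint_union (setX G G) (subgroups G).

Definition generates (p : gT * gT) (H : {group gT}) : bool :=
  H :==: <<[set p.1; p.2]>>.

Definition B_adj : rel bvertex := fun u v =>
  [&& u \in B_vertices, v \in B_vertices &
    match u, v with
    | inl p, inr H | inr H, inl p => generates p H
    | _, _ => false
    end].

Lemma B_adj_sym : symmetric B_adj.
Proof. by move=> [p|H] [q|K]; rewrite /B_adj andbCA. Qed.

Lemma B_adj_irr : irreflexive B_adj.
Proof. by move=> [p|H]; rewrite /B_adj !andbF. Qed.

Lemma B_adj_vertex u v : B_adj u v -> u \in B_vertices.
Proof. by case/andP. Qed.

Definition B_graph : sgraph bvertex := SGraph B_adj_sym B_adj_irr B_adj_vertex.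

Definition cyclic_subgroups : {set {group gT}} :=
  [set H in subgroups G | cyclic H].

Definition Pr_cyc : rat :=
  (#|[set p in setX G G | cyclic <<[set p.1; p.2]>>]|%:R / #|G|%:R ^+ 2)%R.

End GeneratingGraph.

(* Main.v *)
(* Each pair (a,b) of G x G has the single neighbour <a,b> in B(G), and this
   neighbour survives in the induced subgraph exactly when <a,b> is cyclic.
   Hence both the edges and the degrees of the cyclic subgroups count the pairs
   generating a cyclic subgroup, the latter fibre by fibre of (a,b) |-> <a,b>. *)
Require Import Defs.
From mathcomp Require Import all_boot all_order all_algebra all_fingroup all_solvable.
Local Open Scope ring_scope.

Lemma mem_disjoint_union_inl (T1 T2 : finType) (A : {set T1}) (B : {set T2}) x :
  (inl x \in disjoint_union A B) = (x \in A).
Proof.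
rewrite !inE mem_imset; last by move=> ? ? [].
by rewrite orbC; case: imsetP => // -[].
Qed.

Lemma mem_disjoint_union_inr (T1 T2 : finType) (A : {set T1}) (B : {set T2}) y :
  (inr y \in disjoint_union A B) = (y \in B).
Proof.
rewrite !inE [in X in _ || X]mem_imset; last by move=> ? ? [].
by case: imsetP => // -[].
Qed.

Section CyclicInducedSubgraph.
Variables (gT : finGroupType) (G : {group gT}).

Let S := disjoint_union (setX G G) (cyclic_subgroups G).
Let Gamma := induced (B_graph G) S.

(** Bundled as a group, so that it is a map into the type of the subgroup vertices, with fibres to
    sum over. *)
Definition pair_group (p : gT * gT) : {group gT} := <<[set p.1; p.2]>>%G.

Definition cyclic_pairs : {set gT * gT} :=
  [set p in setX G G | cyclic (pair_group p)].

Lemma pair_group_cyclic_subgroup p :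
  p \in cyclic_pairs -> pair_group p \in cyclic_subgroups G.
Proof.
case: p => a b; rewrite !inE /= => /andP[/andP[aG bG] ->].
by rewrite andbT gen_subG subUset !sub1set aG.
Qed.

(** Once [H] is [pair_group p], every membership condition on the two vertices reduces to [p] lying
    in [cyclic_pairs]. *)
Lemma cyclic_induced_adj_lr p H :
  adj Gamma (inl p) (inr H) = (p \in cyclic_pairs) && (H == pair_group p).
Proof.
rewrite /= /induced_adj /= /B_adj /B_vertices /S.
rewrite !mem_disjoint_union_inl !mem_disjoint_union_inr /generates.
(* Equality of bundled groups is by definition equality of their underlying sets. *)
have -> : (H :==: <<[set p.1; p.2]>>)%g = (H == pair_group p) by [].
have [->|_] := eqVneq H (pair_group p); last by rewrite !andbF.
rewrite !andbT; apply/idP/idP => [/and4P[pG HC _ _] | pC].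
  by move: HC; rewrite [_ \in cyclic_pairs]inE pG inE => /andP[].
have HC := pair_group_cyclic_subgroup _ pC.
have HG : pair_group p \in subgroups G by case/setIdP: HC.
by case/setIdP: pC => -> _; rewrite HC HG.
Qed.

Lemma cyclic_induced_adj_ll p q : adj Gamma (inl p) (inl q) = false.
Proof. by rewrite /= /induced_adj /= /B_adj !andbF. Qed.

Lemma cyclic_induced_adj_rr H K : adj Gamma (inr H) (inr K) = false.
Proof. by rewrite /= /induced_adj /= /B_adj !andbF. Qed.

Lemma deg_cyclic_induced H :
  deg Gamma (inr H : bvertex gT) = #|[set p in cyclic_pairs | H == pair_group p]|.
Proof.
(* The fibre is moved into the vertex type along the injection [inl], since a subgroup has only
   pairs as neighbours. *)
rewrite /deg -(@card_imset _ (bvertex gT) inl); last by move=> ? ? [].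
apply: eq_card => -[p|K]; rewrite !inE.
  by rewrite adj_sym cyclic_induced_adj_lr mem_imset ?inE // => ? ? [].
by rewrite cyclic_induced_adj_rr; case: imsetP => // -[].
Qed.

Lemma sum_deg_cyclic_induced :
  (\sum_(H in cyclic_subgroups G) deg Gamma (inr H : bvertex gT))%N
    = #|cyclic_pairs|.
Proof.
rewrite -sum1_card (partition_big pair_group _ pair_group_cyclic_subgroup) /=.
apply: eq_bigr => H _; rewrite deg_cyclic_induced -sum1_card.
by apply: eq_bigl => p; rewrite !inE eq_sym.
Qed.

Definition pair_edge (p : gT * gT) : {set bvertex gT} :=
  [set inl p; inr (pair_group p)].

(** An edge contains exactly one vertex of the form [inl p], which recovers the pair. *)
Lemma pair_edge_inj : injective pair_edge.
Proof.
move=> p q /setP/(_ (inl p)); rewrite !inE eqxx /= orbF.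
by move/esym/eqP => -[].
Qed.

Lemma edges_cyclic_induced : edges Gamma = pair_edge @: cyclic_pairs.
Proof.
apply/setP=> e; apply/imsetP/imsetP => [[[u v]]|[p pC ->]]; last first.
  by exists (inl p, inr (pair_group p)); rewrite ?inE ?cyclic_induced_adj_lr ?pC /=.
rewrite inE => uv ->; have {uv}: adj Gamma u v := uv.
case: u v => [p|H] [q|K].
- by rewrite cyclic_induced_adj_ll.
- by rewrite cyclic_induced_adj_lr => /andP[pC /eqP->]; exists p.
(* The reversed orientation yields the same unordered edge. *)
- rewrite adj_sym cyclic_induced_adj_lr => /andP[qC /eqP->].
  by exists q; rewrite // /pair_edge setUC.
by rewrite cyclic_induced_adj_rr.
Qed.

Lemma card_edges_cyclic_induced : #|edges Gamma| = #|cyclic_pairs|.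
Proof. by rewrite edges_cyclic_induced card_imset //; apply: pair_edge_inj. Qed.

End CyclicInducedSubgraph.

Theorem theorem3p5 (gT : finGroupType) (G : {group gT})
    (S : {set bvertex gT})
    (hS : S = disjoint_union (setX G G) (cyclic_subgroups G)) :
  Pr_cyc G =
    (\sum_(H in cyclic_subgroups G)
       deg (induced (B_graph G) S) (inr H : bvertex gT))%N%:R / #|G|%:R ^+ 2
  /\
  (\sum_(H in cyclic_subgroups G)
       deg (induced (B_graph G) S) (inr H : bvertex gT))%N%:R / #|G|%:R ^+ 2
    = #|edges (induced (B_graph G) S)|%:R / #|G|%:R ^+ 2 :> rat.
Proof.
(* The numerator of [Pr_cyc] is [cyclic_pairs] up to unfolding, so all three quotients now
   coincide. *)
by rewrite hS sum_deg_cyclic_induced card_edges_cyclic_induced.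
Qed.
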